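(* For every $n\ge1$, let $P_n:E_n\to Z_n$ be the projection from the edge space of the Laakso graph $\mathcal{L}_n$ onto its cycle space defined in the context. Then its operator norm on $(E_n,\|\cdot\|_1)$ satisfies $$\|P_n\|_1\le\frac{n+1}{2}.$$
   Context: Laakso graphs (oriented): $\mathcal{L}_0$ is a single oriented edge, from bottom to top. $\mathcal{L}_1$ has vertices $b$ (bottom)$,u,p,q,v,t$ (top) and oriented edges $1: b\to u$, $2: u\to p$, $3: p\to v$, $4: u\to q$, $5: q\to v$, $6: v\to t$. $\mathcal{L}_n$ is obtained from $\mathcal{L}_{n-1}$ by replacing each oriented edge by a copy of $\mathcal{L}_1$, bottom identified with the tail and top with the head. For $0\le j\le n$, $\mathcal{L}_n$ arises from $\mathcal{L}_{n-j}$ by replacing each edge by a copy of $\mathcal{L}_j$; these $6^{n-j}$ copies are the sub-$\mathcal{L}_j$'s of $\mathcal{L}_n$. Each sub-$\mathcal{L}_j$ ($j\ge1$) is the union of six sub-$\mathcal{L}_{j-1}$'s, labelled $A,B,C,D,E,F$, replacing the edges $1,\dots,6$ of $\mathcal{L}_1$ respectively. $E_n=\mathbb{R}^{E(\mathcal{L}_n)}$ is the edge space, with $\ell_1$-norm $\|\cdot\|_1$, $\ell_2$-norm $\|\cdot\|_2$ and standard inner product. The cycle space $Z_n$ is the span of signed indicator functions of cycles (value $\pm1$ on an edge of the cycle according to whether a fixed direction around the cycle agrees with the orientation of the edge, $0$ off the cycle); the cut space $C_n$ is its orthogonal complement. Vectors: $f_0=1$ on a single edge. For $j\ge1$, on $\mathcal{L}_j$: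 $f_j$ equals $f_{j-1}$ on $A,F$ and $\frac12f_{j-1}$ on $B,C,D,E$; $g_j$ equals $-f_{j-1}$ on $A,F$ and $f_{j-1}$ on $B,C,D,E$; $h_j$ equals $0$ on $A,F$, $f_{j-1}$ on $B,C$, $-f_{j-1}$ on $D,E$. For a sub-$\mathcal{L}_j$ $L$ of $\mathcal{L}_n$ ($1\le j\le n$), $G_L$ and $H_L$ are the copies of $g_j$, $h_j$ on $L$ extended by $0$. The non-special cut vectors of $L$ are the three vectors equal to $f_{j-1}$ on one and $-f_{j-1}$ on the other member of one of the pairs $(A,F)$, $(B,C)$, $(D,E)$ of sub-$\mathcal{L}_{j-1}$'s of $L$, and $0$ elsewhere. The vectors $H_L$ (all $L$, all $1\le j\le n$) form an orthogonal basis of $Z_n$; the vector $f_n$, all $G_L$, and all non-special vectors form an orthogonal basis of $C_n$. Definition of $P_n$. $P_n$ is linear and is the identity on $Z_n$, and is determined by its values on the orthogonal basis of $C_n$ consisting of $f_n$, all $G_L$, and all non-special cut vectors ($L$ ranging over all sub-$\mathcal{L}_j$'s of $\mathcal{L}_n$, $1\le j\le n$). $P_1$ is the orthogonal projection of $E_1$ onto $Z_1$. For $n\ge2$: $P_n(f_n)=0$, $P_n(g_n)=0$ and $P_n(g)=0$ for every non-special $g$. If $L$ is a sub-$\mathcal{L}_j$ ($1\le j\le n-1$) contained in the $A$ or $F$ sub-$\mathcal{L}_{n-1}$ of $\mathcal{L}_n$, then $P_n(G_L)$ is the copy of $P_{n-1}(G_L)$ in that sub-$\mathcal{L}_{n-1}$,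 extended by $0$. For the rest, define scalars $x_n=(4/3)^{n-1}$ and, for $j=n-1,\dots,1$, $a_j$ by $(1-a_j)x_{j+1}=(\frac12+a_j)x_{j+1}+(\frac43)^{j-1}$, and $x_j=(1-a_j)x_{j+1}$. Given a chain $L_0\subset L_1\subset\dots\subset L_{n-1}\subset L_n=\mathcal{L}_n$ with $L_i$ a sub-$\mathcal{L}_i$ and $L_{n-1}$ one of $B,C,D,E$, write $G_i=G_{L_i}$, $H_i=H_{L_i}$, and let $\varepsilon_i\in\{-1,0,1\}$ be the constant sign of $H_i$ on $L_{i-1}$ ($0$ if $H_i$ vanishes there). Put $X_n=\varepsilon_n h_n/\|h_n\|_2^2$ and, for $i=n-1,\dots,1$, $X_i=(\frac12+a_i)X_{i+1}+\varepsilon_iH_i/\|H_i\|_2^2$ if $\varepsilon_i\ne0$, and $X_i=(1-a_i)X_{i+1}$ if $\varepsilon_i=0$. ($X_i$ depends only on $L_{i-1}$.) For $1\le j\le n-1$ set $P_n(G_j)=\|G_j\|_2^2\,a_j\,X_{j+1}$. Letting the chain vary defines $P_n(G_L)$ for all sub-$\mathcal{L}_j$'s $L$ ($1\le j\le n-1$) contained in $B$, $C$, $D$ or $E$. *)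

(* Defs.v *)
From HB Require Import structures.
From mathcomp Require Import all_boot all_order all_algebra.
From mathcomp Require Import boolp classical_sets reals.

Set Implicit Arguments.
Unset Strict Implicit.
Unset Printing Implicit Defensive.

Import Order.TTheory GRing.Theory Num.Theory.
Local Open Scope ring_scope.

(* eA, .., eF are the oriented edges 1, .., 6 of L_1. *)
Inductive edge1 := eA | eB | eC | eD | eE | eF.

Definition edge1_code (c : edge1) : 'I_6 :=
  inord match c with
        | eA => 0 | eB => 1 | eC => 2 | eD => 3 | eE => 4 | eF => 5
        end.
Definition edge1_decode (i : 'I_6) : edge1 := nth eF [:: eA; eB; eC; eD; eE] i.
Lemma edge1_codeK : cancel edge1_code edge1_decode.
Proof. by case; rewrite /edge1_decode /edge1_code inordK. Qed.

HB.instance Definition _ := Equality.copy edge1 (can_type edge1_codeK).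
HB.instance Definition _ := Choice.copy edge1 (can_type edge1_codeK).
HB.instance Definition _ := Countable.copy edge1 (can_type edge1_codeK).
HB.instance Definition _ : isFinite edge1 := CanIsFinite edge1_codeK.

Inductive vertex1 := vb | vu | vp | vq | vv | vt.

Definition vertex1_code (x : vertex1) : 'I_6 :=
  inord match x with
        | vb => 0 | vu => 1 | vp => 2 | vq => 3 | vv => 4 | vt => 5
        end.
Definition vertex1_decode (i : 'I_6) : vertex1 :=
  nth vt [:: vb; vu; vp; vq; vv] i.
Lemma vertex1_codeK : cancel vertex1_code vertex1_decode.
Proof. by case; rewrite /vertex1_decode /vertex1_code inordK. Qed.

HB.instance Definition _ := Equality.copy vertex1 (can_type vertex1_codeK).

Definition tail1 (c : edge1) : vertex1 :=
  match c with
  | eA => vb | eB => vu | eC => vp | eD => vu | eE => vq | eF => vv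
  end.

Definition head1 (c : edge1) : vertex1 :=
  match c with
  | eA => vu | eB => vp | eC => vv | eD => vq | eE => vv | eF => vt
  end.

(* An edge of L_n is a word c_n c_(n-1) .. c_1 of length n, outermost letter
   first: replacing the edge w of L_(n-1) by a copy of L_1 yields the edges
   rcons w c of L_n.  Hence the sub-L_j's of L_n are encoded by the words p of
   length n - j: the sub-L_j of p consists of the edges with prefix p, and its
   A, .., F sub-L_(j-1)'s are those of rcons p eA, .., rcons p eF. *)
Notation edge n := (n.-tuple edge1).

(* inl false, inl true: the bottom and the top; inr (w, x), for x one of vu, vp,
   vq, vv: the vertex x of the copy of L_1 that replaces the edge w of the
   Laakso graph of order size w. *)
Definition vertex := (bool + seq edge1 * vertex1)%type.

Definition copy_vertex (w : seq edge1) (b t : vertex) (x : vertex1) : vertex :=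
  match x with vb => b | vt => t | _ => inr (w, x) end.

(* The (tail, head) of the edge w ++ s, where (b, t) is that of the edge w. *)
Fixpoint ends_from (w : seq edge1) (b t : vertex) (s : seq edge1) :
    vertex * vertex :=
  if s is c :: s' then
    ends_from (rcons w c) (copy_vertex w b t (tail1 c))
              (copy_vertex w b t (head1 c)) s'
  else (b, t).

Definition edge_tail (w : seq edge1) : vertex :=
  (ends_from [::] (inl false) (inl true) w).1.
Definition edge_head (w : seq edge1) : vertex :=
  (ends_from [::] (inl false) (inl true) w).2.

(* A step (e, r) traverses the edge e, against its orientation iff r. *)
Definition step n := (edge n * bool)%type.
Definition step_src n (d : step n) : vertex :=
  if d.2 then edge_head d.1 else edge_tail d.1.
Definition step_dst n (d : step n) : vertex :=
  if d.2 then edge_tail d.1 else edge_head d.1.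

Definition is_cycle n (s : seq (step n)) : bool :=
  [&& s != [::], cycle (fun d d' => step_dst d == step_src d') s,
      uniq [seq step_src d | d <- s] & uniq [seq d.1 | d <- s]].

Definition edge_space (R : realType) n := {ffun edge n -> R^o}.

Section Norms.
Variables (R : realType) (n : nat).
Implicit Types x y : edge_space R n.

Definition norm1 x : R := \sum_e `|x e : R|.
Definition dot x y : R := \sum_e (x e : R) * (y e : R).
Definition sqnorm2 x : R := dot x x.

Definition opnorm1 (P : 'End(edge_space R n)) : R :=
  sup [set norm1 (P x) | x in [set x | norm1 x <= 1]]%classic.

End Norms.

Section CycleSpace.
Variables (R : realType) (n : nat).

Definition cycle_vector (s : seq (step n)) : edge_space R n :=
  [ffun e => ((e, false) \in s)%:R - ((e, true) \in s)%:R].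

(* The edges of a cycle being distinct, its length is at most 6 ^ n. *)
Definition cycle_space : {vspace edge_space R n} :=
  <<[seq cycle_vector s | s : (6 ^ n)%N.-bseq (step n)
                          in [pred s | is_cycle (bseqval s)]]>>%VS.

Definition in_cut_space (x : edge_space R n) : Prop :=
  forall z, z \in cycle_space -> dot x z = 0.

End CycleSpace.

Section Vectors.
Variable R : realType.

(* fword, gword and hword give f_j, g_j and h_j on the words of length j, for
   all j at once (g_j and h_j are only meaningful for j >= 1). *)
Fixpoint fword (w : seq edge1) : R :=
  match w with
  | [::] => 1
  | (eA | eF) :: w' => fword w'
  | _ :: w' => 2^-1 * fword w'
  end.

Definition gword (w : seq edge1) : R :=
  match w with
  | [::] => 0
  | (eA | eF) :: w' => - fword w'
  | _ :: w' => fword w'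
  end.

Definition hword (w : seq edge1) : R :=
  match w with
  | [::] => 0
  | (eA | eF) :: _ => 0
  | (eB | eC) :: w' => fword w'
  | (eD | eE) :: w' => - fword w'
  end.

Definition extend0 n (p : seq edge1) (phi : seq edge1 -> R) : edge_space R n :=
  [ffun e : edge n => if prefix p e then phi (drop (size p) e) else 0].

Definition fvec n : edge_space R n := [ffun e : edge n => fword e].
Definition Gvec n (p : seq edge1) : edge_space R n := extend0 n p gword.
Definition Hvec n (p : seq edge1) : edge_space R n := extend0 n p hword.

Definition nonspecial n (p : seq edge1) (c d : edge1) : edge_space R n :=
  extend0 n (rcons p c) fword - extend0 n (rcons p d) fword.

Definition special_pairs : seq (edge1 * edge1) :=
  [:: (eA, eF); (eB, eC); (eD, eE)].

(* The copy of y on the c sub-L_n of L_(n+1), extended by 0. *)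
Definition copy_in n (c : edge1) (y : edge_space R n) : edge_space R n.+1 :=
  [ffun e : edge n.+1 => if thead e == c then y (behead_tuple e) else 0].

End Vectors.

Section Projection.
Variable R : realType.

Definition laakso_scalars (n : nat) (x a : nat -> R) : Prop :=
  x n = (4 / 3) ^+ n.-1 /\
  forall j, (1 <= j < n)%N ->
    (1 - a j) * x j.+1 = (1 / 2 + a j) * x j.+1 + (4 / 3) ^+ j.-1 /\
    x j = (1 - a j) * x j.+1.

(* A chain L_0 < L_1 < .. < L_n is determined by its edge e = L_0:
   L_i is the sub-L_i containing e. *)
Definition chain n (e : edge n) (i : nat) : seq edge1 := take (n - i) e.

(* The sign of H_(L_i) is constant on L_(i-1), which contains e. *)
Definition chain_sign n (e : edge n) (i : nat) : R :=
  Num.sg (Hvec R n (chain e i) e).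

Definition signed_H n (e : edge n) (i : nat) : edge_space R n :=
  (chain_sign e i / sqnorm2 (Hvec R n (chain e i))) *: Hvec R n (chain e i).

(* chain_Xrev a e k is X_(n-k) for the chain of e. *)
Fixpoint chain_Xrev n (a : nat -> R) (e : edge n) (k : nat) : edge_space R n :=
  if k is k'.+1 then
    let i := (n - k)%N in
    if chain_sign e i != 0
    then (1 / 2 + a i) *: chain_Xrev a e k' + signed_H e i
    else (1 - a i) *: chain_Xrev a e k'
  else signed_H e n.

Definition chain_X n (a : nat -> R) (e : edge n) (i : nat) : edge_space R n :=
  chain_Xrev a e (n - i).

Definition projects_onto n (P : 'End(edge_space R n))
    (Z : {vspace edge_space R n}) : Prop :=
  limg P = Z /\ {in Z, forall z, P z = z}.

Fixpoint is_laakso_proj (n : nat) : 'End(edge_space R n) -> Prop :=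
  match n with
  | 0 => fun _ => False
  | m.+1 => fun P =>
    projects_onto P (cycle_space R m.+1) /\
    if m == 0%N then
      forall x, in_cut_space x -> P x = 0
    else
      [/\ [/\ P (fvec R m.+1) = 0,
              P (Gvec R m.+1 [::]) = 0
            & forall p c d, (size p < m.+1)%N -> (c, d) \in special_pairs ->
                P (nonspecial R m.+1 p c d) = 0],
          exists2 Q : 'End(edge_space R m), is_laakso_proj Q &
            forall c p, c \in [:: eA; eF] -> (size p < m)%N ->
              P (Gvec R m.+1 (c :: p)) = copy_in c (Q (Gvec R m p))
        & exists x a, laakso_scalars m.+1 x a /\
            forall (e : edge m.+1) j,
              thead e \in [:: eB; eC; eD; eE] -> (1 <= j < m.+1)%N ->
              let Gj := Gvec R m.+1 (chain e j) in
              P Gj = (sqnorm2 Gj * a j) *: chain_X a e j.+1]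
  end.

End Projection.

(* Main.v *)
Require Import Defs.
From HB Require Import structures.
From mathcomp Require Import all_boot all_order all_algebra.
From mathcomp Require Import boolp classical_sets reals ring lra zify.

Set Implicit Arguments.
Unset Strict Implicit.
Unset Printing Implicit Defensive.

Import Order.TTheory GRing.Theory Num.Theory.
Local Open Scope ring_scope.

(* Let F_p be the copy of f_j on the sub-Laakso graph of the word p.  The vectors
   F_(pA), .., F_(pF) are combinations of F_p, G_p, H_p and the non-special vectors
   of p, so these span the edge space and determine P_n.  Read backwards, the
   relations say that P_n (F_p) = 3^j X_(j+1) for the chains of B, C, D, E, and
   that this prescription on single edges does define P_n.  The scalars are
   x_j = (4/3)^(j-1) (n-j+2)/2, and they are chosen so that |X_j|_1 <= x_j; for
   an edge this gives the bound x_1 = (n+1)/2, and in the A and F parts the bound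
   for P_(n-1) applies.

   Cut vectors are orthogonal to cycles because they are gradients of potentials.
   H_p lies in the cycle space because C_(pB) + C_(pC) - C_(pD) - C_(pE) is a
   cycle vector, where C_w indicates the path through w that only uses A, B, C, F,
   and because F_w - C_w is inductively a combination of such vectors. *)

(** * Vectors supported on a sub-Laakso graph *)

Lemma big_edge1 (V : nmodType) (f : edge1 -> V) :
  \sum_c f c = f eA + f eB + f eC + f eD + f eE + f eF.
Proof.
have decodeK : cancel edge1_decode edge1_code.
  by move=> i; apply/val_inj; rewrite /= /edge1_code; case: i => -[|[|[|[|[|[|[]]]]]]] //= ?; rewrite inordK.
rewrite (reindex edge1_decode); last first.
  by exists edge1_code => c _; rewrite ?decodeK ?edge1_codeK.
by rewrite !big_ord_recr big_ord0 /= add0r.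
Qed.

Lemma card_edge1 : #|{: edge1}| = 6%N.
Proof. by rewrite -sum1_card big_edge1. Qed.

Lemma edge1_eqE (c d : edge1) :
  (c == d) = match c, d with
    | eA, eA | eB, eB | eC, eC | eD, eD | eE, eE | eF, eF => true | _, _ => false end.
Proof. by case: c; case: d; apply/eqP. Qed.

Lemma prefix_rcons_nth (p s : seq edge1) c : (size p < size s)%N ->
  prefix (rcons p c) s = prefix p s && (nth eA s (size p) == c).
Proof. by move=> ps; rewrite !prefixE size_rcons (take_nth eA) // eqseq_rcons. Qed.

(** Induction from the edges up: a word comes after its six one-letter extensions, that is, a
    sub-Laakso graph after its six parts. *)
Lemma word_ind n (Pr : seq edge1 -> Prop) :
  (forall p, size p = n -> Pr p) ->
  (forall p, (size p < n)%N -> (forall c, Pr (rcons p c)) -> Pr p) ->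
  forall p, (size p <= n)%N -> Pr p.
Proof.
move=> Pn Prec p; move: {-2}(n - size p)%N (erefl (n - size p)%N) => k.
elim: k p => [|k IH] p pk pn; first by apply: Pn; lia.
by apply: Prec => [|c]; [lia | apply: IH; rewrite size_rcons; lia].
Qed.

Section Extend.
Variables (R : realType) (n : nat).
Local Notation E := (edge_space R n).
Implicit Types (p : seq edge1) (phi psi : seq edge1 -> R) (x y : E) (e : edge n).

Lemma extend0_split p phi : (size p < n)%N ->
  extend0 n p phi = \sum_c extend0 n (rcons p c) (fun s => phi (c :: s)).
Proof.
move=> pn; apply/ffunP => e; rewrite sum_ffunE ffunE.
have pe : (size p < size e)%N by rewrite size_tuple.
under eq_bigr do rewrite ffunE prefix_rcons_nth // size_rcons.
case: (prefix p e); last by rewrite big1.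
rewrite (bigD1 (nth eA e (size p))) //= eqxx big1 ?addr0 => [|c].
  by rewrite (drop_nth eA).
by rewrite eq_sym => /negPf ->.
Qed.

Lemma extend0_cons p phi psi (k : edge1 -> R) : (size p < n)%N ->
  (forall c s, phi (c :: s) = k c * psi s) ->
  extend0 n p phi = \sum_c k c *: extend0 n (rcons p c) psi.
Proof.
move=> pn phiE; rewrite extend0_split //; apply: eq_bigr => c _.
by apply/ffunP => e; rewrite !ffunE phiE; case: ifP => _; rewrite // scaler0.
Qed.

Lemma sum_extend0_cons p phi psi (k : edge1 -> R) : (size p < n)%N ->
  (forall c s, phi (c :: s) = k c * psi s) ->
  \sum_e (extend0 n p phi e : R) =
  \sum_c k c * \sum_e (extend0 n (rcons p c) psi e : R).
Proof.
move=> pn /(extend0_cons pn) ->.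
under eq_bigr do rewrite sum_ffunE.
rewrite exchange_big /=; apply: eq_bigr => c _.
by rewrite mulr_sumr; apply: eq_bigr => e _; rewrite ffunE.
Qed.

Lemma extend0_tuple e phi : extend0 n e phi = [ffun e' => if e' == e then phi [::] else 0].
Proof.
apply/ffunP => e'; rewrite !ffunE prefixE size_tuple take_oversize ?size_tuple //.
by rewrite -val_eqE /=; case: eqP => // _; rewrite drop_oversize ?size_tuple.
Qed.

Lemma sum_extend0 p phi (k : edge1 -> R) : (size p <= n)%N ->
  (forall c s, phi (c :: s) = k c * phi s) ->
  \sum_e (extend0 n p phi e : R) = (\sum_c k c) ^+ (n - size p) * phi [::].
Proof.
move=> pn phiE; move: p pn; apply: word_ind => [p pn|p pn IH].
  rewrite pn subnn expr0 mul1r -[p]/(val (Tuple (introT eqP pn))) extend0_tuple.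
  rewrite (bigD1 (Tuple (introT eqP pn))) //= big1 ?addr0 ?ffunE ?eqxx // => e.
  by rewrite ffunE => /negPf ->.
rewrite (sum_extend0_cons pn phiE); under eq_bigr do rewrite IH size_rcons.
by rewrite -mulr_suml mulrA -exprS -subSn.
Qed.

End Extend.

(** * The spanning vectors, their relations and their norms *)

Section Basis.
Variables (R : realType) (n : nat).
Local Notation E := (edge_space R n).
Local Notation F p := (extend0 n p (@fword R)).
Implicit Types (p : seq edge1) (x y : E) (e : edge n).

Definition fcoef c : R := fword R [:: c].
Definition gcoef c : R := gword R [:: c].
Definition hcoef c : R := hword R [:: c].

Lemma fword_cons c s : fword R (c :: s) = fcoef c * fword R s.
Proof. by case: c; rewrite /fcoef /= ?mulr1 ?mul1r. Qed.
Lemma gword_cons c s : gword R (c :: s) = gcoef c * fword R s.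
Proof. by case: c; rewrite /gcoef /= ?mul1r ?mulN1r. Qed.
Lemma hword_cons c s : hword R (c :: s) = hcoef c * fword R s.
Proof. by case: c; rewrite /hcoef /= ?mul1r ?mulN1r ?mul0r. Qed.

Lemma fword_gt0 s : 0 < fword R s.
Proof.
elim: s => [|c s IH]; rewrite ?ltr01 // fword_cons; apply: mulr_gt0 => //.
by case: c; rewrite /fcoef /= ?mulr1 ?ltr01 ?invr_gt0 ?ltr0n.
Qed.

Lemma fvecE : fvec R n = F [::].
Proof. by apply/ffunP => e; rewrite !ffunE prefix0s drop0. Qed.

Lemma F_split p : (size p < n)%N -> F p = \sum_c fcoef c *: F (rcons p c).
Proof. by move=> pn; apply: extend0_cons => // c s; rewrite fword_cons. Qed.
Lemma G_split p : (size p < n)%N -> Gvec R n p = \sum_c gcoef c *: F (rcons p c).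
Proof. by move=> pn; apply: extend0_cons => // c s; rewrite gword_cons. Qed.
Lemma H_split p : (size p < n)%N -> Hvec R n p = \sum_c hcoef c *: F (rcons p c).
Proof. by move=> pn; apply: extend0_cons => // c s; rewrite hword_cons. Qed.

Definition partner c :=
  match c with eA => eF | eF => eA | eB => eC | eC => eB | eD => eE | eE => eD end.

Lemma nonspecialC p c d : nonspecial R n p c d = - nonspecial R n p d c.
Proof. by rewrite /nonspecial opprB. Qed.

Lemma partner_special c : (c, partner c) \in special_pairs \/ (partner c, c) \in special_pairs.
Proof. by case: c; rewrite !inE !eqxx ?orbT; auto. Qed.

(** The six vectors of [p] on the right form an orthogonal basis of the span of the parts
    [F (rcons p c)]. The coefficients are inner products over squared norms, the latter being 3, 6,
    4 and 2 times the squared norm of [F (rcons p c)]. *)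
Lemma F_rcons p c : (size p < n)%N ->
  F (rcons p c) = (fcoef c / 3) *: F p + (gcoef c / 6) *: Gvec R n p
   + (hcoef c / 4) *: Hvec R n p + 2^-1 *: nonspecial R n p c (partner c).
Proof.
move=> pn; rewrite (F_split pn) (G_split pn) (H_split pn) !big_edge1.
apply/ffunP => e; rewrite /nonspecial [LHS]ffunE.
by case: c; rewrite !ffunE /fcoef /gcoef /hcoef /GRing.scale /=; field.
Qed.

Lemma edge_space_expand x : x = \sum_e (x e : R) *: F e.
Proof.
apply/ffunP => e; rewrite sum_ffunE (bigD1 e) //= big1 => [|e' e'e].
  by rewrite addr0 ffunE extend0_tuple ffunE eqxx /GRing.scale /= mulr1.
by rewrite ffunE extend0_tuple ffunE eq_sym (negPf e'e) scaler0.
Qed.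

(** [F_rcons], applied from the whole graph down to single edges, shows that these vectors span the
    edge space. *)
Lemma edge_space_ind (Pr : E -> Prop) :
  (forall a x y, Pr x -> Pr y -> Pr (a *: x + y)) -> Pr (fvec R n) ->
  (forall p, (size p < n)%N -> Pr (Gvec R n p)) ->
  (forall p, (size p < n)%N -> Pr (Hvec R n p)) ->
  (forall p c d, (size p < n)%N -> (c, d) \in special_pairs -> Pr (nonspecial R n p c d)) ->
  forall x, Pr x.
Proof.
move=> PrL Prf PrG PrH Prns.
have Pr0 : Pr 0 by rewrite -(subrr (fvec R n)) addrC -scaleN1r; apply: PrL.
have PrZ a x : Pr x -> Pr (a *: x) by move=> /(PrL a x 0); rewrite addr0; apply.
have PrD x y : Pr x -> Pr y -> Pr (x + y) by move=> Prx; rewrite -[x]scale1r; apply: PrL.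
have PrF p : (size p <= n)%N -> Pr (F p).
  elim/last_ind: p => [|p c IH]; first by rewrite -fvecE.
  rewrite size_rcons => pn; rewrite F_rcons //.
  have Prp := IH (ltnW pn).
  apply: (PrD _ _ (PrD _ _ (PrD _ _ _ _) _)); apply/PrZ; [by []|exact: PrG|exact: PrH|].
  case: (partner_special c) => cd; first exact: Prns.
  by rewrite nonspecialC -scaleN1r; apply/PrZ/Prns.
move=> x; rewrite (edge_space_expand x); elim/big_ind: _ => // e _.
by apply/PrZ/PrF; rewrite size_tuple.
Qed.

Lemma sqnorm2_extend0 p (phi : seq edge1 -> R) :
  sqnorm2 (extend0 n p phi) = \sum_e (extend0 n p (fun s => phi s ^+ 2) e : R).
Proof. by apply: eq_bigr => e _; rewrite !ffunE; case: ifP; rewrite ?mulr0. Qed.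

Lemma norm1_extend0 p (phi : seq edge1 -> R) :
  norm1 (extend0 n p phi) = \sum_e (extend0 n p (fun s => `|phi s|) e : R).
Proof. by apply: eq_bigr => e _; rewrite !ffunE; case: ifP; rewrite ?normr0. Qed.

(** Each level multiplies the sum by 1 + 1 + 4 / 2 = 4; for the squares, in the next lemma, by 1 + 1
    + 4 / 4 = 3. *)
Lemma sum_F p : (size p <= n)%N -> \sum_e (F p e : R) = 4 ^+ (n - size p).
Proof.
move=> pn; rewrite (sum_extend0 pn fword_cons) mulr1 big_edge1 /fcoef /=.
by congr (_ ^+ _); field.
Qed.

Lemma sum_F2 p : (size p <= n)%N ->
  \sum_e (extend0 n p (fun s => fword R s ^+ 2) e : R) = 3 ^+ (n - size p).
Proof.
move=> pn; rewrite (sum_extend0 (k := fun c => fcoef c ^+ 2) pn) => [|c s].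
  by rewrite expr1n mulr1 big_edge1 /fcoef /=; congr (_ ^+ _); field.
by rewrite fword_cons exprMn.
Qed.

Lemma sqnorm2G p : (size p < n)%N ->
  sqnorm2 (Gvec R n p) = 6 * 3 ^+ (n - (size p).+1).
Proof.
move=> pn; rewrite sqnorm2_extend0 (sum_extend0_cons (k := fun c => gcoef c ^+ 2)
  (psi := fun s => fword R s ^+ 2) pn) => [|c s]; last by rewrite gword_cons exprMn.
under eq_bigr do rewrite sum_F2 ?size_rcons //.
by rewrite -mulr_suml big_edge1 /gcoef /=; congr (_ * _); ring.
Qed.

Lemma sqnorm2H p : (size p < n)%N ->
  sqnorm2 (Hvec R n p) = 4 * 3 ^+ (n - (size p).+1).
Proof.
move=> pn; rewrite sqnorm2_extend0 (sum_extend0_cons (k := fun c => hcoef c ^+ 2)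
  (psi := fun s => fword R s ^+ 2) pn) => [|c s]; last by rewrite hword_cons exprMn.
under eq_bigr do rewrite sum_F2 ?size_rcons //.
by rewrite -mulr_suml big_edge1 /hcoef /=; congr (_ * _); ring.
Qed.

(** Divided by [sqnorm2H] this is (4/3)^(j-1) on a sub-graph of order j, the constant in the
    recursion for the scalars. *)
Lemma norm1H p : (size p < n)%N ->
  norm1 (Hvec R n p) = 4 * 4 ^+ (n - (size p).+1).
Proof.
move=> pn; rewrite norm1_extend0 (sum_extend0_cons (k := fun c => `|hcoef c|)
  (psi := fword R) pn) => [|c s]; last by rewrite hword_cons normrM (gtr0_norm (fword_gt0 _)).
under eq_bigr do rewrite sum_F ?size_rcons //.
by rewrite -mulr_suml big_edge1 /hcoef /= normr0 normr1 normrN1; congr (_ * _); ring.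
Qed.

End Basis.

(** * Gradients are orthogonal to cycles *)

Lemma ends_from_rcons w b t s c :
  ends_from w b t (rcons s c) =
  let bt := ends_from w b t s in
  (copy_vertex (w ++ s) bt.1 bt.2 (tail1 c), copy_vertex (w ++ s) bt.1 bt.2 (head1 c)).
Proof.
elim: s w b t => [|d s IH] w b t /=; first by rewrite cats0.
by rewrite IH cat_rcons.
Qed.

Definition vertex_in w x : vertex := copy_vertex w (edge_tail w) (edge_head w) x.

Lemma edge_tail_rcons w c : edge_tail (rcons w c) = vertex_in w (tail1 c).
Proof. by rewrite /edge_tail ends_from_rcons. Qed.

Lemma edge_head_rcons w c : edge_head (rcons w c) = vertex_in w (head1 c).
Proof. by rewrite /edge_head ends_from_rcons. Qed.

Section Gradient.
Variables (R : realType) (n : nat).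
Implicit Types (w p : seq edge1).

Lemma dot_sumr (x : edge_space R n) (I : finType) (k : I -> R) (y : I -> edge_space R n) :
  dot x (\sum_i k i *: y i) = \sum_i k i * dot x (y i).
Proof.
under [RHS]eq_bigr do rewrite mulr_sumr.
rewrite exchange_big; apply: eq_bigr => e _; rewrite sum_ffunE mulr_sumr.
by apply: eq_bigr => i _; rewrite ffunE mulrCA.
Qed.

Lemma sum_cycle_vector (x : edge_space R n) (s : seq (step n)) : uniq s ->
  dot x (cycle_vector R s) =
  \sum_(d <- s) (if d.2 then - (x d.1 : R) else x d.1).
Proof.
move=> s_uniq; rewrite big_uniq //= big_mkcond /=.
rewrite (eq_bigr (fun d => (fun e (r : bool) => if (e, r) \in s then
  if r then - (x e : R) else x e else 0) d.1 d.2)); last by case.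
rewrite -(pair_bigA _ (fun e (r : bool) => if (e, r) \in s then
  if r then - (x e : R) else x e else 0)) /=.
apply: eq_bigr => e _; rewrite ffunE big_bool /= mulrBr.
by case: ((e, false) \in s) ((e, true) \in s) => [] []; rewrite ?mulr1 ?mulr0 addrC ?oppr0.
Qed.

(** In a closed walk the destinations are the sources shifted by one step. *)
Lemma sum_cycle (T : Type) (V : nmodType) (src dst : T -> vertex) (phi : vertex -> V) (s : seq T) :
  cycle (fun d d' => dst d == src d') s ->
  \sum_(d <- s) phi (dst d) = \sum_(d <- s) phi (src d).
Proof.
have path_sum (p : seq T) d : path (fun d d' => dst d == src d') d p ->
    \sum_(d <- belast d p) phi (dst d) = \sum_(d <- p) phi (src d).
  elim: p d => [|d' p IH] d; first by rewrite !big_nil.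
  by rewrite /= !big_cons => /andP[/eqP -> /IH ->].
case: s => [|d s]; first by rewrite !big_nil.
by move=> /path_sum; rewrite belast_rcons => ->; rewrite -cats1 big_cat big_seq1 big_cons addrC.
Qed.

(* [S w] stands for the height difference between the ends of the sub-graph [w]. *)
Definition heights (S : seq edge1 -> R) : Prop :=
  forall w, (size w < n)%N ->
    S w = S (rcons w eA) + S (rcons w eB) + S (rcons w eC) + S (rcons w eF) /\
    S (rcons w eB) + S (rcons w eC) = S (rcons w eD) + S (rcons w eE).

Variable S : seq edge1 -> R.
Hypothesis heightsS : heights S.

(** The height of [x] above the bottom of [w]; for [vv] it is measured through [vp]. *)
Definition offset w (x : vertex1) : R :=
  match x with
  | vb => 0 | vu => S (rcons w eA) | vp => S (rcons w eA) + S (rcons w eB)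
  | vq => S (rcons w eA) + S (rcons w eD)
  | vv => S (rcons w eA) + S (rcons w eB) + S (rcons w eC) | vt => S w
  end.

(** The height of the tail of [w] above the bottom of the whole graph, summed over the levels. *)
Definition base w : R :=
  \sum_(i < size w) offset (take i w) (tail1 (nth eA w i)).

Lemma base_rcons w c : base (rcons w c) = base w + offset w (tail1 c).
Proof.
rewrite /base size_rcons big_ord_recr /= -cats1 take_size_cat // nth_cat ltnn subnn.
congr (_ + _); apply: eq_bigr => i _.
by rewrite take_cat nth_cat ltn_ord.
Qed.

Definition potential (v : vertex) : R :=
  match v with
  | inl b => if b then S [::] else 0
  | inr (w, x) => base w + offset w x
  end.

Lemma potential_edge w : (size w <= n)%N ->
  potential (edge_tail w) = base w /\ potential (edge_head w) = base w + S w.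
Proof.
elim/last_ind: w => [|w c IH]; first by rewrite /base big_ord0 add0r.
rewrite size_rcons => wn; have [IHt IHh] := IH (ltnW wn).
have [SE SBC] := heightsS wn.
have vE x : potential (vertex_in w x) = base w + offset w x.
  by case: x; rewrite /vertex_in //= ?IHt ?addr0.
rewrite edge_tail_rcons edge_head_rcons !vE base_rcons; split=> //.
(* Equality of the two sides of the diamond is used at E, the total height at F. *)
rewrite -addrA; congr (_ + _); case: c => /=; rewrite ?SE; lra.
Qed.

(** The vector is the gradient of [potential], so its signed sum along a cycle telescopes to 0;
    linearity extends this to the span. *)
Lemma heights_in_cut : in_cut_space ([ffun e : edge n => S e] : edge_space R n).
Proof.
have cycle0 (s : seq (step n)) : is_cycle s ->
    dot ([ffun e : edge n => S e] : edge_space R n) (cycle_vector R s) = 0.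
  case/and4P => _ cyc _ s_uniq; rewrite sum_cycle_vector; last exact: map_uniq s_uniq.
  have stepE d : (if d.2 then - ([ffun e : edge n => S e] d.1 : R)
      else ([ffun e : edge n => S e] d.1 : R)) =
      potential (step_dst d) - potential (step_src d).
    case: d => e r; have en : (size e <= n)%N by rewrite size_tuple.
    have [tE hE] := potential_edge en.
    by case: r; rewrite ffunE /step_dst /step_src /= tE hE; lra.
  rewrite (eq_bigr _ (fun d _ => stepE d)) sumrB.
  by rewrite (sum_cycle potential cyc) subrr.
move=> z; rewrite /cycle_space; set X := (X in <<X>>%VS) => zX.
have /coord_span -> : z \in <<in_tuple X>>%VS by [].
have X0 (y : edge_space R n) : y \in X -> dot [ffun e : edge n => S e] y = 0.
  rewrite /X => /mapP[s]; rewrite mem_enum => s_cyc ->; exact: cycle0.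
by rewrite dot_sumr big1 // => i _; rewrite X0 ?mulr0 ?mem_nth.
Qed.

End Gradient.

(** * Height functions of the cut vectors *)

Section CutVectors.
Variables (R : realType) (n : nat).
Local Notation E := (edge_space R n).
Local Notation F p := (extend0 n p (@fword R)).
Implicit Types (w p : seq edge1).

Lemma fword_rcons s c : fword R (rcons s c) = fword R s * fcoef R c.
Proof.
by elim: s => [|d s IH]; rewrite ?mul1r // rcons_cons !(fword_cons _ d) IH mulrA.
Qed.

Lemma extend0_in_cut (phi S : seq edge1 -> R) p : 
  heights n S ->
  (forall w, size w = n -> S w = if prefix p w then phi (drop (size p) w) else 0) ->
  in_cut_space (extend0 n p phi : E).
Proof.
move=> hS SE; suff -> : extend0 n p phi = [ffun e : edge n => S e] by apply: heights_in_cut.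
by apply/ffunP => e; rewrite !ffunE SE // size_tuple.
Qed.

Lemma fvec_in_cut : in_cut_space (fvec R n).
Proof.
(* The route A, B, C, F has total weight 1 + 1/2 + 1/2 + 1 = 3, so a sub-graph of order j has height
   3^j times its weight. *)
rewrite fvecE; apply: (extend0_in_cut (S := fun w => fword R w * 3 ^+ (n - size w))).
  move=> w wn; rewrite !size_rcons !fword_rcons /fcoef /= -[(n - size w)%N](@subnSK (size w)) // exprS.
  by split; field.
by move=> w wn; rewrite prefix0s drop0 wn subnn expr0 mulr1.
Qed.

(** The equations give the sub-graph of [p] total height 0 and its diamond two equal sides, so the
    extension by 0 is still a gradient. *)
Lemma local_in_cut p phi (k : edge1 -> R) : phi [::] = 0 ->
  (forall c s, phi (c :: s) = k c * fword R s) ->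
  k eA + k eB + k eC + k eF = 0 -> k eB + k eC = k eD + k eE ->
  in_cut_space (extend0 n p phi : E).
Proof.
move=> phi0 phiE k0 kBC.
apply: (extend0_in_cut (S := fun w => if prefix p w then
  phi (drop (size p) w) * 3 ^+ (n - size w) else 0)); last first.
  by move=> w wn; rewrite wn subnn expr0 mulr1.
move=> w wn; rewrite !size_rcons -[(n - size w)%N](@subnSK (size w)) //.
have [/prefixP[u ->]|pw] := boolP (prefix p w); last first.
  (* An extension of such a [w] by one letter either still lacks the prefix or is [p] itself, where
     [phi [::] = 0]. *)
  have S0 c : (if prefix p (rcons w c) then
      phi (drop (size p) (rcons w c)) * 3 ^+ (n - (size w).+1) else 0) = 0.
    case: ifP => // /prefixP[u]; case/lastP: u => [|u d].
      by rewrite cats0 => <-; rewrite drop_size phi0 mul0r.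
    by rewrite -rcons_cat => /rcons_inj[wE _]; rewrite wE prefix_prefix in pw.
  by rewrite !S0 !addr0.
rewrite !rcons_cat !prefix_prefix !drop_size_cat // exprS.
case: u => [|d u] /=; first by rewrite !phiE /= !mulr1 -!mulrDl k0 kBC phi0 !mul0r.
by rewrite !phiE !fword_rcons /fcoef /=; split; field.
Qed.

Lemma G_in_cut p : in_cut_space (Gvec R n p).
Proof.
apply: (@local_in_cut p (gword R) (gcoef R)) => //; first exact: gword_cons.
all: by rewrite /gcoef /=; ring.
Qed.

Lemma nonspecial_in_cut p c d : (size p < n)%N -> (c, d) \in special_pairs ->
  in_cut_space (nonspecial R n p c d).
Proof.
move=> pn cd; pose k b : R := (b == c)%:R - (b == d)%:R.
have -> : nonspecial R n p c d =
    extend0 n p (fun s => if s is b :: s' then k b * fword R s' else 0).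
  rewrite (extend0_cons (k := k) (psi := fword R)) // /k.
  rewrite (eq_bigr (fun b => (b == c)%:R *: F (rcons p b) - (b == d)%:R *: F (rcons p b))).
    rewrite sumrB (bigD1 c) //= eqxx scale1r big1 => [|b /negPf ->]; last by rewrite scale0r.
    rewrite addr0 [X in _ - X](bigD1 d) //= eqxx scale1r big1 => [|b /negPf ->]; last by rewrite scale0r.
    by rewrite addr0.
  by move=> b _; rewrite scalerBl.
apply: (@local_in_cut _ _ k) => //.
all: by move: cd; rewrite !inE /k => /or3P[] /eqP[-> ->]; rewrite !edge1_eqE /=; ring.
Qed.

End CutVectors.

(** * Cycles and the vectors H_p *)

Fixpoint linked (T : Type) (V : eqType) (src dst : T -> V) (x : V) (s : seq T) (y : V) : bool :=
  if s is d :: s' then (src d == x) && linked src dst (dst d) s' y else x == y.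

Lemma linked_cat (T : Type) (V : eqType) (src dst : T -> V) x y z s t :
  linked src dst x s y -> linked src dst y t z -> linked src dst x (s ++ t) z.
Proof.
elim: s x => [|d s IH] x /=; first by move/eqP->.
by case/andP=> -> /IH.
Qed.

Lemma linked_cycle (T : Type) (V : eqType) (src dst : T -> V) x s :
  linked src dst x s x -> cycle (fun d d' => dst d == src d') s.
Proof.
have linked_path d0 d t : linked src dst (dst d) t (src d0) ->
    path (fun d d' => dst d == src d') d (rcons t d0).
  elim: t d => [|d' t IH] d /=; first by rewrite andbT.
  by rewrite [_ == src d']eq_sym => /andP[-> /IH].
by case: s => //= d s /andP[/eqP <-]; apply: linked_path.
Qed.

Lemma uniq_flatten_map (T U : eqType) (f : U -> seq T) (s : seq U) :
  uniq s -> {in s, forall c, uniq (f c)} ->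
  {in s &, forall c c' x, x \in f c -> x \in f c' -> c = c'} ->
  uniq (flatten [seq f c | c <- s]).
Proof.
elim: s => //= c s IH /andP[cs s_uniq] f_uniq f_disj; rewrite cat_uniq f_uniq ?mem_head //=.
rewrite IH // ?andbT => [|d ds|d d' ds ds']; last 2 first.
- by apply: f_uniq; rewrite inE ds orbT.
- by apply: f_disj; rewrite inE ?ds ?ds' orbT.
apply/hasPn => x /flatten_mapP[d ds xd]; apply/negP => xc.
by move: cs; rewrite (f_disj c d _ _ x) ?ds // inE ?eqxx ?ds ?orbT.
Qed.

Definition word_edge n (w : seq edge1) : edge n := insubd (nseq_tuple n eA) w.

Lemma val_word_edge n w : size w = n -> val (word_edge n w) = w.
Proof. by move=> wn; rewrite val_insubd wn eqxx. Qed.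

(** Interior vertices of the sub-graph of [w]: those created in [w] or in one of its refinements. *)
Definition inside (w : seq edge1) (v : vertex) : bool :=
  if v is inr (w', _) then prefix w w' else false.

Lemma vertex_in_outside w c x :
  ~~ inside w (edge_tail w) -> ~~ inside w (edge_head w) ->
  ~~ inside (rcons w c) (vertex_in w x).
Proof.
have sub v : ~~ inside w v -> ~~ inside (rcons w c) v.
  case: v => [//|[w' y]] /=; apply: contra => /(prefix_trans _); apply.
  exact: prefix_rcons.
have wcw : ~~ prefix (rcons w c) w.
  by apply/negP => /prefixP[t /(congr1 size)]; rewrite size_cat size_rcons; lia.
by move=> /sub wt /sub wh; case: x.
Qed.

Lemma vertex_in_injective w :
  ~~ inside w (edge_tail w) -> ~~ inside w (edge_head w) ->
  edge_tail w != edge_head w -> injective (vertex_in w).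
Proof.
have in_w x : inside w (inr (w, x)) by exact: prefix_refl.
move=> wt wh th x y; case: x; case: y => //=; rewrite /vertex_in /=.
all: try by [move=> []|move=> E; rewrite E in_w in wt|move=> E; rewrite -E in_w in wt
  |move=> E; rewrite E in_w in wh|move=> E; rewrite -E in_w in wh
  |move=> E; rewrite E eqxx in th].
Qed.

(** The three claims need each other: distinct ends outside [w] make [vertex_in w] injective, which
    separates the ends of each refined edge. *)
Lemma edge_ends_outside w :
  [/\ ~~ inside w (edge_tail w), ~~ inside w (edge_head w) & edge_tail w != edge_head w].
Proof.
elim/last_ind: w => [|w c [wt wh th]]; first by [].
rewrite edge_tail_rcons edge_head_rcons; split; try exact: vertex_in_outside.
by apply/negP => /eqP /(vertex_in_injective wt wh th); case: c.
Qed.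

Definition in_route (c : edge1) : bool := match c with eD | eE => false | _ => true end.

Definition dir_src (d : edge1 * bool) : vertex1 := if d.2 then head1 d.1 else tail1 d.1.
Definition dir_dst (d : edge1 * bool) : vertex1 := if d.2 then tail1 d.1 else head1 d.1.

Definition route (r : bool) : seq (edge1 * bool) :=
  if r then [:: (eF, true); (eC, true); (eB, true); (eA, true)]
  else [:: (eA, false); (eB, false); (eC, false); (eF, false)].

Lemma uniq_map_injective (T U : eqType) (f : T -> U) (s : seq T) :
  uniq (map f s) -> {in s &, injective f}.
Proof.
elim: s => //= a s IH /andP[fas /IH inj_s] x y.
rewrite !inE => /predU1P[->|xs] /predU1P[->|ys] // fxy; last exact: inj_s.
- by rewrite fxy map_f in fas.
- by rewrite -fxy map_f in fas.
Qed.

(** * Walks through a sub-Laakso graph *)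

Section Walks.
Variable n : nat.

(** The path through [w] that takes A, B, C, F at every level, reversed when [r]; it is meant for
    [size w + j = n]. *)
Fixpoint walk (j : nat) (w : seq edge1) (r : bool) : seq (step n) :=
  if j is j'.+1 then flatten [seq walk j' (rcons w d.1) d.2 | d <- route r]
  else [:: (word_edge n w, r)].

Definition walk_along j w (ds : seq (edge1 * bool)) : seq (step n) :=
  flatten [seq walk j (rcons w d.1) d.2 | d <- ds].

Definition start w (r : bool) := if r then edge_head w else edge_tail w.

Lemma start_rcons w d : start (rcons w d.1) d.2 = vertex_in w (dir_src d).
Proof. by rewrite /start /dir_src edge_tail_rcons edge_head_rcons; case: d.2. Qed.

Lemma start_rconsN w d : start (rcons w d.1) (~~ d.2) = vertex_in w (dir_dst d).
Proof. by rewrite /start /dir_dst edge_tail_rcons edge_head_rcons; case: d.2. Qed.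

Notation slinked := (linked (@step_src n) (@step_dst n)).

Lemma linked_along j w ds x y :
  (forall d, slinked (start (rcons w d.1) d.2) (walk j (rcons w d.1) d.2) (start (rcons w d.1) (~~ d.2))) ->
  linked dir_src dir_dst x ds y ->
  slinked (vertex_in w x) (walk_along j w ds) (vertex_in w y).
Proof.
move=> link; elim: ds x => [|d ds IH] x /=; first by move/eqP->.
case/andP=> /eqP <- /IH; apply: linked_cat.
by rewrite -start_rcons -start_rconsN.
Qed.

Lemma linked_walk j w r : (size w + j = n)%N ->
  slinked (start w r) (walk j w r) (start w (~~ r)).
Proof.
elim: j w r => [|j IH] w r wj.
  have wn : size w = n by lia.
  by rewrite /= /step_src /step_dst /= val_word_edge // /start; case: r; rewrite !eqxx.
have startE b : start w b = vertex_in w (if b then vt else vb) by case: b.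
rewrite !startE; apply: linked_along => [d|].
  by apply: IH; rewrite size_rcons; lia.
by case: r => /=; rewrite /dir_src /dir_dst /= !eqxx.
Qed.

(** The edges of the walk are exactly the support of C_w, which lets [loop_in] read off the cycle
    vector of the loop. *)
Lemma mem_walk j w r (e : edge n) b : (size w + j = n)%N ->
  ((e, b) \in walk j w r) = [&& b == r, prefix w e & all in_route (drop (size w) e)].
Proof.
elim: j w r => [|j IH] w r wj.
  have wn : size w = n by lia.
  rewrite inE xpair_eqE andbC -val_eqE /= val_word_edge // prefixE.
  rewrite take_oversize ?drop_oversize ?size_tuple ?wn // ?andbT; reflexivity.
have we : (size w < size e)%N by rewrite size_tuple -wj addnS ltnS leq_addr.
have IHc c b' : ((e, b) \in walk j (rcons w c) b') =
    [&& b == b', prefix w e, nth eA e (size w) == c & all in_route (drop (size w).+1 e)].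
  by rewrite IH ?size_rcons; [rewrite prefix_rcons_nth // -!andbA | lia].
rewrite (drop_nth eA) //=; case: r => /=; rewrite !mem_cat !IHc !edge1_eqE;
by case: (nth eA e (size w)); rewrite /= ?andbF ?andbT ?orbF ?orbT.
Qed.

Lemma walk_src j w r d : (size w + j = n)%N -> d \in walk j w r ->
  step_src d = start w r \/ inside w (step_src d).
Proof.
elim: j w r => [|j IH] w r wj.
  rewrite inE => /eqP ->; left; rewrite /step_src /start /= val_word_edge //; lia.
case/flatten_mapP => d' d'r /IH[|->|in_wc]; first by rewrite size_rcons; lia.
  rewrite start_rcons; case: r d'r; rewrite !inE => /or4P[] /eqP -> /=;
  by [left|right; apply: prefix_refl].
right; case: (step_src d) in_wc => [//|[w' y]] /=.
by move/(prefix_trans (prefix_rcons w d'.1)).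
Qed.

Lemma uniq_walk_along_edges j w ds : (size w + j.+1 = n)%N ->
  (forall d, uniq [seq d'.1 | d' <- walk j (rcons w d.1) d.2]) ->
  uniq [seq d.1 | d <- ds] -> uniq [seq d.1 | d <- walk_along j w ds].
Proof.
move=> wj parts ds_uniq.
rewrite /walk_along map_flatten -map_comp; apply: uniq_flatten_map.
- exact: map_uniq ds_uniq.
- by move=> d _ /=.
move=> d d' dds d'ds e /mapP[[e1 b] e1d /= ->] /mapP[[e2 b'] e2d' /= e12].
move: e1d e2d'; rewrite -{}e12 !mem_walk ?size_rcons; try lia.
have we : (size w < size e1)%N by rewrite size_tuple -wj addnS ltnS leq_addr.
rewrite !prefix_rcons_nth // => /and3P[_ /andP[_ /eqP d1] _] /and3P[_ /andP[_ /eqP d'1] _].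
by apply: (uniq_map_injective ds_uniq) => //; rewrite -d1 -d'1.
Qed.
(** By [walk_src] each source is the start of its part or interior to it. Starts are distinct by
    [src_uniq], interiors of different parts are disjoint, and no vertex of the copy of L_1 is
    interior to a part. *)
Lemma uniq_walk_along_srcs j w ds : (size w + j.+1 = n)%N ->
  (forall d, uniq [seq step_src d' | d' <- walk j (rcons w d.1) d.2]) ->
  uniq [seq d.1 | d <- ds] -> uniq [seq dir_src d | d <- ds] ->
  uniq [seq step_src d | d <- walk_along j w ds].
Proof.
move=> wj parts ds_uniq src_uniq; have [wt wh th] := edge_ends_outside w.
rewrite /walk_along map_flatten -map_comp; apply: uniq_flatten_map.
- exact: map_uniq ds_uniq.
- by move=> d _ /=.
move=> d d' dds d'ds v /mapP[e ed ->] /mapP[e' e'd'].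
have sz (c : edge1) : (size (rcons w c) + j = n)%N by rewrite size_rcons addSnnS.
have out c x : ~~ inside (rcons w c) (vertex_in w x) by apply: vertex_in_outside.
case: (walk_src (sz _) ed) (walk_src (sz _) e'd') => [->|in_d] [->|in_d'] E.
- apply: (uniq_map_injective src_uniq) => //.
  by apply: (vertex_in_injective wt wh th); rewrite -!start_rcons.
- by rewrite -E start_rcons (negPf (out _ _)) in in_d'.
- by rewrite E start_rcons (negPf (out _ _)) in in_d.
- apply: (uniq_map_injective ds_uniq) => //; move: in_d in_d'; rewrite -E.
  case: (step_src e) => // -[w' y] /= /prefixP[t1 ->] /prefixP[t2].
  by rewrite !cat_rcons => /eqP; rewrite eqseq_cat // eqxx => /eqP[].
Qed.

Lemma uniq_route r : uniq [seq d.1 | d <- route r] && uniq [seq dir_src d | d <- route r].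
Proof.
by case: r; rewrite /dir_src /= !inE !edge1_eqE; apply/and5P; split=> //;
  do ?[apply/norP; split | apply/andP; split]; apply/eqP.
Qed.

Lemma uniq_walk j w r : (size w + j = n)%N ->
  uniq [seq d.1 | d <- walk j w r] && uniq [seq step_src d | d <- walk j w r].
Proof.
elim: j w r => [//|j IH] w r wj; have /andP[r1 r2] := uniq_route r.
have IHd (d : edge1 * bool) : (size (rcons w d.1) + j = n)%N.
  by rewrite size_rcons addSnnS.
apply/andP; split.
  by apply: uniq_walk_along_edges => // d; have /andP[] := IH _ d.2 (IHd d).
by apply: uniq_walk_along_srcs => // d; have /andP[] := IH _ d.2 (IHd d).
Qed.

(** The diamond of L_1: up through B and C, down through E and D. *)
Definition loop : seq (edge1 * bool) :=
  [:: (eB, false); (eC, false); (eE, true); (eD, true)].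

Lemma loop_is_cycle j w : (size w + j.+1 = n)%N -> is_cycle (walk_along j w loop).
Proof.
move=> wj.
have IHd (d : edge1 * bool) : (size (rcons w d.1) + j = n)%N.
  by rewrite size_rcons addSnnS.
have loop1 : uniq [seq d.1 | d <- loop] by rewrite /= !inE !edge1_eqE.
apply/and4P; split.
- apply/negP => /eqP loop0.
  have : (word_edge n (w ++ eB :: nseq j eA), false) \in walk_along j w loop.
    have sz : size (w ++ eB :: nseq j eA) = n by rewrite size_cat /= size_nseq.
    rewrite /walk_along [flatten _]/= mem_cat mem_walk /=; last by rewrite size_rcons addSnnS.
    rewrite -[tval _]/(val (word_edge _ _)) (val_word_edge sz) -cat_rcons prefix_prefix drop_size_cat //.
    by rewrite all_nseq /= orbT.
  by rewrite loop0.
- have : slinked (vertex_in w vu) (walk_along j w loop) (vertex_in w vu).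
    apply: linked_along => [d|]; first exact: linked_walk.
    by rewrite /= /dir_src /dir_dst /= !eqxx.
  exact: linked_cycle.
- apply: uniq_walk_along_srcs => // d; by have /andP[] := uniq_walk d.2 (IHd d).
- apply: uniq_walk_along_edges => // d; by have /andP[] := uniq_walk d.2 (IHd d).
Qed.
End Walks.

(** * Membership of the vectors H_p in the cycle space *)

Section CycleVectors.
Variables (R : realType) (n : nat).
Local Notation E := (edge_space R n).
Local Notation F p := (extend0 n p (@fword R)).
Local Notation Z := (cycle_space R n).
Implicit Types (w p : seq edge1).

Lemma cycle_vector_in (s : seq (step n)) : is_cycle s -> cycle_vector R s \in Z.
Proof.
move=> s_cyc; have s_size : (size s <= 6 ^ n)%N.
  have /and4P[_ _ _ s_uniq] := s_cyc.
  have := max_card [in [seq d.1 | d <- s]].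
  by rewrite (card_uniqP s_uniq) size_map card_tuple card_edge1.
by apply/memv_span/mapP; exists (Bseq s_size); rewrite ?mem_enum.
Qed.

Definition route_word (s : seq edge1) : R := (all in_route s)%:R.
Local Notation C p := (extend0 n p route_word).
Definition routecoef c : R := (in_route c)%:R.

Lemma C_split p : (size p < n)%N -> C p = \sum_c routecoef c *: C (rcons p c).
Proof.
move=> pn; apply: extend0_cons => // c s.
by rewrite /route_word /routecoef /=; case: in_route; rewrite ?mul1r ?mul0r.
Qed.

Lemma loop_in p : (size p < n)%N ->
  C (rcons p eB) + C (rcons p eC) - C (rcons p eD) - C (rcons p eE) \in Z.
Proof.
move=> pn; have pj : (size p + (n - (size p).+1).+1 = n)%N by lia.
have <- : cycle_vector R (walk_along n (n - (size p).+1) p loop) =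
   C (rcons p eB) + C (rcons p eC) - C (rcons p eD) - C (rcons p eE).
  apply/ffunP => e; have pe : (size p < size e)%N by rewrite size_tuple.
  have sz c : (size (rcons p c) + (n - (size p).+1) = n)%N by rewrite size_rcons addSnnS.
  rewrite !ffunE /walk_along /= !mem_cat !mem_walk // !size_rcons !prefix_rcons_nth //.
  rewrite !edge1_eqE /route_word; case: (prefix p e) => /=; last by rewrite !subr0 addr0.
  by case: (nth eA e (size p)) => /=; rewrite ?orbF ?addr0 ?add0r ?subr0 ?sub0r ?oppr0 ?add0r.
exact/cycle_vector_in/loop_is_cycle.
Qed.

(** The coefficients in [F_split] minus those in [C_split] are 0 on A, F, then -1/2 on B, C and 1/2
    on D, E: this is -1/2 times the diamond loop. *)
Lemma F_subC_in p : (size p <= n)%N -> F p - C p \in Z.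
Proof.
move: p; apply: word_ind => [p pn|p pn IH].
  have -> : F p = C p; last by rewrite subrr mem0v.
  by rewrite -[p]/(val (Tuple (introT eqP pn))) !extend0_tuple.
have -> : F p - C p = \sum_c fcoef R c *: (F (rcons p c) - C (rcons p c)) -
    2^-1 *: (C (rcons p eB) + C (rcons p eC) - C (rcons p eD) - C (rcons p eE)).
  rewrite (F_split _ pn) (C_split pn) !big_edge1; apply/ffunP => e.
  by rewrite !ffunE /routecoef /fcoef /GRing.scale /=; field.
by rewrite rpredB ?rpredZ ?loop_in ?rpred_sum // => c _; rewrite rpredZ.
Qed.

Lemma H_in p : (size p < n)%N -> Hvec R n p \in Z.
Proof.
move=> pn; have -> : Hvec R n p = \sum_c hcoef R c *: (F (rcons p c) - C (rcons p c)) +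
    (C (rcons p eB) + C (rcons p eC) - C (rcons p eD) - C (rcons p eE)).
  rewrite (H_split _ pn) !big_edge1; apply/ffunP => e.
  by rewrite !ffunE /hcoef /GRing.scale /=; ring.
by rewrite rpredD ?loop_in ?rpred_sum // => c _; rewrite rpredZ // F_subC_in ?size_rcons.
Qed.

End CycleVectors.

(** * Orthogonal decomposition and norms *)

Section Norms.
Variables (R : realType) (n : nat).
Local Notation E := (edge_space R n).
Local Notation F p := (extend0 n p (@fword R)).
Implicit Types x y : E.

Lemma norm1D x y : norm1 (x + y) <= norm1 x + norm1 y.
Proof. by rewrite -big_split ler_sum // => e _; rewrite ffunE ler_normD. Qed.

Lemma norm1Z a x : norm1 (a *: x) = `|a| * norm1 x.
Proof. by rewrite mulr_sumr; apply: eq_bigr => e _; rewrite ffunE normrM. Qed.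

Lemma norm1_0 : norm1 (0 : E) = 0.
Proof. by rewrite /norm1 big1 // => e _; rewrite ffunE normr0. Qed.

Lemma norm1_sum (I : finType) (f : I -> E) : norm1 (\sum_i f i) <= \sum_i norm1 (f i).
Proof.
elim/big_ind2: _ => [|x1 x2 y1 y2 h1 h2|//]; first by rewrite norm1_0.
by apply: le_trans (norm1D _ _) _; rewrite lerD.
Qed.

Lemma norm1F (e : edge n) : norm1 (F e) = 1.
Proof.
rewrite norm1_extend0 -(_ : F e = extend0 n e (fun s => `|fword R s|)).
  by rewrite sum_F size_tuple // subnn expr0.
by apply/ffunP => e'; rewrite !ffunE (gtr0_norm (fword_gt0 _ _)).
Qed.

Lemma dot_eq0 x : dot x x = 0 -> x = 0.
Proof.
move=> /eqP; rewrite psumr_eq0 => [|e _]; last by rewrite -expr2 sqr_ge0.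
by move=> /allP x0; apply/ffunP => e; have /eqP := x0 e (mem_index_enum _);
  rewrite /= ffunE => /eqP; rewrite mulf_eq0 orbb => /eqP.
Qed.

(** The unit ball is the convex hull of the vectors [F e] and their negatives, so it suffices to
    bound the images of these. *)
Lemma opnorm1_le (P : 'End(E)) (b : R) :
  (forall e : edge n, norm1 (P (F e)) <= b) -> 0 <= b -> opnorm1 P <= b.
Proof.
move=> Pb b0; apply: ge_sup => [|_ [x /= x1 <-]].
  by exists (norm1 (P 0)); exists 0 => //=; rewrite norm1_0 ler01.
rewrite {1}(edge_space_expand x) linear_sum.
apply: le_trans (norm1_sum _) _; apply: (@le_trans _ _ (\sum_e `|x e : R| * b)).
  by apply: ler_sum => e _; rewrite linearZ norm1Z; apply: ler_wpM2l; [exact: normr_ge0 | exact: Pb].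
by rewrite -mulr_suml ler_piMl.
Qed.

End Norms.

(** * Splitting into cut and cycle components *)

Section Decomposition.
Variables (R : realType) (n : nat).
Local Notation E := (edge_space R n).
Local Notation F p := (extend0 n p (@fword R)).
Local Notation Z := (cycle_space R n).

Lemma in_cutL a (x y : E) : in_cut_space x -> in_cut_space y -> in_cut_space (a *: x + y).
Proof.
move=> cx cy z zZ; have -> : dot (a *: x + y) z = a * dot x z + dot y z.
  rewrite /dot mulr_sumr -big_split; apply: eq_bigr => e _.
  by rewrite !ffunE /GRing.scale /= mulrDl mulrA.
by rewrite cx // cy // mulr0 addr0.
Qed.

(** The spaces [K] and [W] record which vectors make up each component: [K] becomes a kernel in
    [in_cut_kernel], [W] an upper bound for the cycle space in [cycle_space_sub]. *)
Lemma cut_cycle_decomposition (K W : {vspace E}) :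
  fvec R n \in K -> (forall p, (size p < n)%N -> Gvec R n p \in K) ->
  (forall p c d, (size p < n)%N -> (c, d) \in special_pairs -> nonspecial R n p c d \in K) ->
  (forall p, (size p < n)%N -> Hvec R n p \in W) ->
  forall x, exists u v, [/\ x = u + v, in_cut_space u, u \in K, v \in Z & v \in W].
Proof.
move=> Kf KG Kns WH.
have cut0 : in_cut_space (0 : E).
  by move=> z _; rewrite /dot big1 // => e _; rewrite ffunE mul0r.
apply: edge_space_ind => [a _ _ [u [v [-> cu Ku Zv Wv]]] [u' [v' [-> cu' Ku' Zv' Wv']]]||p pn|p pn|p c d pn cd].
- exists (a *: u + u'), (a *: v + v'); split; rewrite ?rpredD ?rpredZ //.
    by rewrite scalerDr addrACA.
  exact: in_cutL.
- by exists (fvec R n), 0; split; rewrite ?addr0 ?mem0v //; apply: fvec_in_cut.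
- by exists (Gvec R n p), 0; split; rewrite ?addr0 ?mem0v ?KG //; apply: G_in_cut.
- by exists 0, (Hvec R n p); split; rewrite ?add0r ?mem0v ?H_in ?WH.
- by exists (nonspecial R n p c d), 0; split; rewrite ?addr0 ?mem0v ?Kns //; apply: nonspecial_in_cut.
Qed.

Lemma cut_cycle0 (u : E) : in_cut_space u -> u \in Z -> u = 0.
Proof. by move=> cu /cu; apply: dot_eq0. Qed.

(** The cut component of a cycle space element is itself in the cycle space, hence orthogonal to
    itself and 0. Together with [H_in], the [Hvec] thus span the cycle space. *)
Lemma cycle_space_sub (W : {vspace E}) :
  (forall p, (size p < n)%N -> Hvec R n p \in W) -> (Z <= W)%VS.
Proof.
move=> HW; apply/subvP => z zZ; have [u [v [zE cu _ vZ vW]]] :=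
  cut_cycle_decomposition (memvf _) (fun p _ => memvf _) (fun p c d _ _ => memvf _) HW z.
suff u0 : u = 0 by rewrite zE u0 add0r.
by apply: cut_cycle0 => //; rewrite -[u](addrK v) -zE rpredB.
Qed.

Lemma projects_ontoP (P : 'End(E)) :
  (forall p, (size p < n)%N -> P (Hvec R n p) = Hvec R n p) ->
  (forall e : edge n, P (F e) \in Z) -> projects_onto P Z.
Proof.
move=> PH PF.
have PZ : {in Z, forall z, P z = z}.
  move=> z zZ; apply/fixedSpaceP; apply: (subvP (cycle_space_sub _) _ zZ) => p pn.
  exact/fixedSpaceP/PH.
split=> //; apply/eqP; rewrite eqEsubv; apply/andP; split; apply/subvP => x.
  case/memv_imgP => y _ ->; rewrite (edge_space_expand y) linear_sum memv_suml // => e _.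
  by rewrite linearZ; apply: memvZ; apply: PF.
by move=> xZ; rewrite -(PZ x xZ) memv_img ?memvf.
Qed.

Lemma in_cut_kernel (P : 'End(E)) :
  P (fvec R n) = 0 -> (forall p, (size p < n)%N -> P (Gvec R n p) = 0) ->
  (forall p c d, (size p < n)%N -> (c, d) \in special_pairs -> P (nonspecial R n p c d) = 0) ->
  forall x, in_cut_space x -> P x = 0.
Proof.
move=> Pf PG Pns x cx.
have K y : P y = 0 -> y \in lker P by rewrite memv_ker => ->.
have [u [v [xE cu uK vZ _]]] := cut_cycle_decomposition (K _ Pf) (fun p pn => K _ (PG p pn))
  (fun p c d pn cd => K _ (Pns p c d pn cd)) (fun p _ => memvf _) x.
have v0 : v = 0.
  apply: cut_cycle0 => //; have -> : v = -1 *: u + x by rewrite xE scaleN1r addKr.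
  exact: in_cutL.
by rewrite xE v0 addr0; apply/eqP; rewrite -memv_ker.
Qed.

End Decomposition.

(** * Closed form of the scalars *)

Section Scalars.
Variable R : realType.

(** The solution of [laakso_scalars]: (1/2 - 2 a_j) x_(j+1) = (4/3)^(j-1) gives a_j = 1/4 - 3 / (4
    (n - j + 1)). *)
Definition acoef n j : R := 1 / 4 - 3 / 4 / (n - j).+1%:R.
Definition xcoef n j : R := (4 / 3) ^+ j.-1 * (n - j).+2%:R / 2.

Lemma scalar_step n j : (1 <= j < n)%N ->
  (1 - acoef n j) * xcoef n j.+1 = (1 / 2 + acoef n j) * xcoef n j.+1 + (4 / 3) ^+ j.-1 /\
  xcoef n j = (1 - acoef n j) * xcoef n j.+1.
Proof.
case: j => // j /andP[_ jn]; rewrite /acoef /xcoef /=.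
have -> : (n - j.+1 = (n - j.+2).+1)%N by lia.
move: (n - j.+2)%N => k; rewrite exprS -[k.+3%:R]natr1 -[k.+2%:R]natr1 -[k.+1%:R]natr1.
have k0 : k%:R >= 0 :> R by rewrite ler0n.
by split; field; lra.
Qed.

Lemma xcoef_n n : (0 < n)%N -> xcoef n n = (4 / 3) ^+ n.-1.
Proof. by move=> n0; rewrite /xcoef subnn; field. Qed.

Lemma xcoef_gt0 n j : 0 < xcoef n j.
Proof. by rewrite /xcoef divr_gt0 ?mulr_gt0 ?exprn_gt0 ?ltr0n ?divr_gt0 ?ltr0n. Qed.

Lemma laakso_scalars_exist n : (0 < n)%N -> laakso_scalars n (xcoef n) (acoef n).
Proof. by move=> n0; split; [rewrite xcoef_n | apply: scalar_step]. Qed.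

(** Downwards from [x n]: once x_(j+1) is known and positive, the first equation determines a_j, and
    the second then x_j. *)
Lemma laakso_scalars_unique n x a j : laakso_scalars n x a -> (1 <= j < n)%N -> a j = acoef n j.
Proof.
case=> xn xa jn.
have aE i : (1 <= i < n)%N -> x i.+1 = xcoef n i.+1 -> a i = acoef n i.
  move=> ijn xi; have [+ _] := xa i ijn; have [+ _] := scalar_step ijn.
  rewrite xi => E1 E2; have := xcoef_gt0 n i.+1 => x0.
  have : (a i - acoef n i) * xcoef n i.+1 = 0 by lra.
  by move/eqP; rewrite mulf_eq0 (gt_eqF x0) orbF subr_eq0 => /eqP.
have xE k : (k < n)%N -> x (n - k)%N = xcoef n (n - k).
  elim: k => [|k IH] kn; first by rewrite subn0 xn xcoef_n //; lia.
  have nk : (1 <= n - k.+1 < n)%N by lia.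
  have := IH (ltnW kn); rewrite -(subnSK (ltnW kn)) => xk.
  have [_ ->] := xa _ nk; have [_ ->] := scalar_step nk.
  by rewrite xk aE.
apply: aE => //; have -> : (j.+1 = n - (n - j.+1))%N by lia.
by apply: xE; lia.
Qed.

End Scalars.

(** * The vectors X of a chain *)

Section ChainVectors.
Variables (R : realType) (n : nat) (a : nat -> R).
Local Notation E := (edge_space R n).
Local Notation F p := (extend0 n p (@fword R)).

Definition outer (c : edge1) : bool := match c with eA | eF => true | _ => false end.

Definition turn c i : R := if outer c then 1 - a i else 1 / 2 + a i.

(** The recursion for X_i peels off the innermost letter, hence the reversed word. [turn] and
    [hcoef] merge its two cases, 4 * 3^(i-1) is the squared norm of H_i, and the start at 0 turns
    the first step into X_n. *)
Fixpoint Xrev (q : seq edge1) : E :=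
  if q is c :: q' then
    turn c (n - size q') *: Xrev q' +
    (hcoef R c / (4 * 3 ^+ (n - (size q').+1))) *: Hvec R n (rev q')
  else 0.
(** For a nonempty [p] encoding a sub-graph of order j, this is X_(j+1). *)
Definition X p := Xrev (rev p).

Lemma X_rcons p c : X (rcons p c) = turn c (n - size p) *: X p +
  (hcoef R c / (4 * 3 ^+ (n - (size p).+1))) *: Hvec R n p.
Proof. by rewrite /X rev_rcons /= size_rev revK. Qed.

Lemma signed_HE (e : edge n) k : (k < n)%N ->
  signed_H R e (n - k) =
  (hcoef R (nth eA e k) / (4 * 3 ^+ (n - k.+1))) *: Hvec R n (take k e).
Proof.
move=> kn; rewrite /signed_H /chain_sign /chain subKn ?(ltnW kn) //.
have ke : (k < size e)%N by rewrite size_tuple.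
have sz : size (take k e) = k by rewrite size_takel // ltnW.
rewrite sqnorm2H sz //; congr ((_ / _) *: _).
rewrite ffunE prefixE sz eqxx (drop_nth eA) // hword_cons sgrM.
rewrite (gtr0_sg (fword_gt0 _ _)) mulr1; case: (nth eA e k);
  by rewrite /hcoef /= ?sgr0 ?sgr1 ?sgrN1.
Qed.

Lemma chain_sign_neq0 (e : edge n) k : (k < n)%N ->
  (chain_sign R e (n - k) != 0) = ~~ outer (nth eA e k).
Proof.
move=> kn; rewrite /chain_sign /chain subKn ?(ltnW kn) // sgr_eq0.
have ke : (k < size e)%N by rewrite size_tuple.
have sz : size (take k e) = k by rewrite size_takel // ltnW.
rewrite ffunE prefixE sz eqxx (drop_nth eA) // hword_cons mulf_eq0 (gt_eqF (fword_gt0 _ _)) orbF.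
by case: (nth eA e k); rewrite /hcoef /= ?eqxx ?oppr_eq0 ?oner_eq0.
Qed.

(** Index 0 stands for X_n, which already depends on the first letter of the edge; hence the prefix
    of length [k.+1]. *)
Lemma chain_XrevE (e : edge n) k : (k < n)%N -> chain_Xrev a e k = X (take k.+1 e).
Proof.
have se : size e = n := size_tuple e.
elim: k => [|k IH] kn.
  rewrite (take_nth eA) ?se // take0 X_rcons /= scaler0 add0r.
  by have := signed_HE e kn; rewrite subn0 take0.
rewrite /= chain_sign_neq0 // IH ?(ltnW kn) // [in RHS](take_nth eA) ?se // X_rcons.
have sz : size (take k.+1 e) = k.+1 by rewrite size_takel // se ltnW.
rewrite signed_HE // sz /turn; case: (nth eA e k.+1) => //=;
by rewrite /hcoef /= mul0r scale0r addr0.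
Qed.

Lemma X_in p : (size p <= n)%N -> X p \in cycle_space R n.
Proof.
elim/last_ind: p => [|p c IH]; first by rewrite mem0v.
by rewrite size_rcons X_rcons => pn; rewrite memvD // memvZ // ?H_in // IH // ltnW.
Qed.

(** The scalars balance the two cases of the recursion: both (1 - a_j) x_(j+1) and (1/2 + a_j)
    x_(j+1) + (4/3)^(j-1) equal x_j. *)
Lemma X_norm p : (forall j, (1 <= j < n)%N -> a j = acoef R n j) ->
  (0 < size p <= n)%N -> norm1 (X p) <= xcoef R n (n - (size p).-1).
Proof.
move=> aE; elim/last_ind: p => [//|p c IH]; rewrite size_rcons /= => pn.
rewrite X_rcons.
have Hn : norm1 ((hcoef R c / (4 * 3 ^+ (n - (size p).+1))) *: Hvec R n p) =
    `|hcoef R c| * (4 / 3) ^+ (n - (size p).+1).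
  rewrite norm1Z norm1H // normrM normfV (ger0_norm (_ : 0 <= 4 * 3 ^+ _)); last first.
    by rewrite mulr_ge0 ?exprn_ge0 ?ler0n.
  have : (3 : R) ^+ (n - (size p).+1) != 0 by rewrite expf_neq0 // pnatr_eq0.
  by rewrite expr_div_n => *; field.
have [p0|p0] := posnP (size p).
  have -> : X p = 0 by rewrite (size0nil p0).
  rewrite scaler0 add0r Hn p0 subn0 xcoef_n ?subn1; last by lia.
  rewrite -[leRHS]mul1r ler_wpM2r ?exprn_ge0 ?divr_ge0 ?ler0n //.
  by case: c {Hn}; rewrite /hcoef /= ?normr0 ?normrN1 ?normr1 ?ler01.
apply: le_trans (norm1D _ _) _; rewrite Hn norm1Z.
have jn : (1 <= n - size p < n)%N by lia.
have [E1 E2] := scalar_step R jn.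
have IHp : norm1 (X p) <= xcoef R n (n - size p).+1.
  by rewrite (_ : (n - size p).+1 = (n - (size p).-1)%N); [apply: IH|]; lia.
have -> : (n - (size p).+1 = (n - size p).-1)%N by lia.
have a_bounds : -(1/2) <= acoef R n (n - size p) <= 1.
  have : 0 <= (n - (n - size p)).+1%:R^-1 :> R by rewrite invr_ge0 ler0n.
  have : (n - (n - size p)).+1%:R^-1 <= 1 :> R by rewrite invf_le1 ?ltr0n // ler1n.
  by rewrite /acoef; move: (_.+1%:R^-1) => r r1 r0; apply/andP; split; lra.
rewrite /turn aE //; have [oc|oc] := boolP (outer c).
  have -> : hcoef R c = 0 by case: c oc {Hn}.
  rewrite normr0 mul0r addr0 E2 ger0_norm; last by lra.
  by apply: ler_wpM2l => //; lra.
have -> : `|hcoef R c| = 1 by case: c oc {Hn} => //; rewrite /hcoef /= ?normrN1 ?normr1.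
rewrite E2 E1 ger0_norm; last by lra.
rewrite !mul1r lerD2r; apply: ler_wpM2l => //; lra.
Qed.

(** * From the six parts of a sub-Laakso graph to the graph itself *)

Section Values.
Variable P : 'End(E).

(** The factor is the squared norm of [F p], just as [sqnorm2 Gj] occurs in the prescription for
    G_j. *)
Definition X_value p := P (F p) = 3 ^+ (n - size p) *: X p.

Variable p : seq edge1.
Hypothesis pn : (size p < n)%N.
Hypothesis X_children : forall c, X_value (rcons p c).

Let s : R := 3 ^+ (n - (size p).+1).

Let X_value_child c : P (F (rcons p c)) = (s * turn c (n - size p)) *: X p + (hcoef R c / 4) *: Hvec R n p.
Proof.
rewrite X_children size_rcons X_rcons scalerDr !scalerA -/s; congr (_ *: _ + _ *: _).
have : s != 0 by rewrite expf_neq0 // pnatr_eq0.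
by rewrite -/s => *; field.
Qed.

Let X_value_sum (k : edge1 -> R) : P (\sum_c k c *: F (rcons p c)) =
  (s * \sum_c k c * turn c (n - size p)) *: X p + ((\sum_c k c * hcoef R c) / 4) *: Hvec R n p.
Proof.
rewrite linear_sum mulr_sumr mulr_suml !scaler_suml -big_split; apply: eq_bigr => c _.
by rewrite linearZ /= X_value_child scalerDr !scalerA [k c * (s * _)]mulrCA -mulrA.
Qed.

(** The weights give 2 (1 - a) + 4 / 2 (1/2 + a) = 3 whatever [a] is, and the multiples of [Hvec]
    cancel. *)
Lemma X_value_parent : X_value p.
Proof.
rewrite /X_value F_split // X_value_sum !big_edge1 /turn /hcoef /fcoef /=.
rewrite -(subnSK pn) exprS -/s; apply/ffunP => e; rewrite !ffunE /GRing.scale /=.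
by field.
Qed.

(** Here the weights give -2 (1 - a) + 4 (1/2 + a) = 6 a, and the multiples of [Hvec] cancel
    again. *)
Lemma X_value_G : P (Gvec R n p) = (sqnorm2 (Gvec R n p) * a (n - size p)) *: X p.
Proof.
rewrite sqnorm2G // G_split // X_value_sum !big_edge1 /turn /hcoef /gcoef /=.
rewrite -/s; apply/ffunP => e; rewrite !ffunE /GRing.scale /=; by field.
Qed.

Lemma X_value_H : P (Hvec R n p) = Hvec R n p.
Proof.
rewrite {1}H_split // X_value_sum !big_edge1 /turn /hcoef /=.
rewrite -/s; apply/ffunP => e; rewrite !ffunE /GRing.scale /=; by field.
Qed.

Lemma X_value_nonspecial c d : (c, d) \in special_pairs -> P (nonspecial R n p c d) = 0.
Proof.
rewrite /nonspecial linearB /= !X_value_child !inE => /or3P[] /eqP[-> ->];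
by rewrite /turn /hcoef /= subrr.
Qed.

End Values.
End ChainVectors.

(** * Linear maps prescribed on edges, and copies inside a larger graph *)

Section LinearExtension.
Variables (R : realType) (n : nat) (V : lmodType R) (v : edge n -> V).

Definition extension (x : edge_space R n) : V := \sum_e (x e : R) *: v e.

Lemma extension_is_linear : linear extension.
Proof.
move=> k x y; rewrite /extension scaler_sumr -big_split; apply: eq_bigr => e _.
by rewrite !ffunE scalerDl scalerA.
Qed.

HB.instance Definition _ := GRing.isLinear.Build R (edge_space R n) V _ extension extension_is_linear.

Lemma extensionF (e : edge n) : extension (extend0 n e (@fword R)) = v e.
Proof.
rewrite /extension (bigD1 e) //= big1 => [|e' e'e].
  by rewrite addr0 extend0_tuple ffunE eqxx scale1r.
by rewrite extend0_tuple ffunE (negPf e'e) scale0r.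
Qed.

End LinearExtension.

Section Copies.
Variables (R : realType) (n : nat) (c : edge1).
Local Notation copy := (@copy_in R n c).

Lemma copy_in_linear : linear copy.
Proof.
move=> k x y; apply/ffunP => e; rewrite !ffunE.
by case: ifP; rewrite ?ffunE // scaler0 addr0.
Qed.

HB.instance Definition _ := GRing.isLinear.Build R (edge_space R n) (edge_space R n.+1) _ copy copy_in_linear.

Lemma extend0_copy p (phi : seq edge1 -> R) : extend0 n.+1 (c :: p) phi = copy (extend0 n p phi).
Proof.
apply/ffunP => e; rewrite !ffunE; case/tupleP: e => d e; rewrite theadE prefix_cons /= eq_sym.
rewrite /behead_tuple /=.
by case: eqP => //=.
Qed.

Lemma copy_nonspecial p b d : nonspecial R n.+1 (c :: p) b d = copy (nonspecial R n p b d).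
Proof. by rewrite /nonspecial linearB /= -!extend0_copy. Qed.

Lemma norm1_copy y : norm1 (copy y) <= norm1 y.
Proof.
rewrite {1}(edge_space_expand y) linear_sum; apply: le_trans (norm1_sum _) _.
apply: ler_sum => e _; rewrite linearZ norm1Z /= -extend0_copy.
by rewrite -[_ :: _]/(val (cons_tuple c e)) norm1F mulr1.
Qed.

Lemma copy_cycle_space y : y \in cycle_space R n -> copy y \in cycle_space R n.+1.
Proof.
move=> yZ; have copyE x : copy x = linfun copy x by rewrite lfunE.
rewrite copyE memv_preim; apply: (subvP (cycle_space_sub _) _ yZ) => p pn.
by rewrite -memv_preim -copyE -extend0_copy; apply: H_in.
Qed.
End Copies.

(** * The projection *)

(** What the induction on the order hands over. It holds for the zero map on a single edge, whereas
    [is_laakso_proj] starts at order 1. *)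
Definition tame_projection (R : realType) n (Q : 'End(edge_space R n)) : Prop :=
  [/\ projects_onto Q (cycle_space R n), Q (fvec R n) = 0,
      forall p c d, (size p < n)%N -> (c, d) \in special_pairs -> Q (nonspecial R n p c d) = 0
    & forall e : edge n, norm1 (Q (extend0 n e (@fword R))) <= n.+1%:R / 2].

Section Step.
Variables (R : realType) (m : nat) (Q : 'End(edge_space R m)).
Local Notation n := m.+1.
Local Notation F p := (extend0 n p (@fword R)).
Local Notation a := (acoef R n).

(** P_n on single edges: copied from [Q] in A and F, and X_1 of the chain in B, C, D, E, where the
    factor 3^j is 1. *)
Definition edge_image (e : edge n) : edge_space R n :=
  if outer (thead e) then copy_in (thead e) (Q (extend0 m (behead_tuple e) (@fword R)))
  else X n a e.

Definition laakso_step : 'End(edge_space R n) := linfun (extension edge_image).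
Local Notation P := laakso_step.

Lemma laakso_stepF (e : edge n) : P (F e) = edge_image e.
Proof. by rewrite lfunE /= extensionF. Qed.

Lemma laakso_step_copy c y : outer c -> P (copy_in c y) = copy_in c (Q y).
Proof.
move=> oc; rewrite {1 2}(edge_space_expand y) !linear_sum; apply: eq_bigr => e _.
rewrite !linearZ /= -extend0_copy; congr (_ *: _).
rewrite -[c :: e]/(val (cons_tuple c e)) laakso_stepF /edge_image theadE oc.
by congr (copy_in c (Q (extend0 m _ _))).
Qed.

(** True on edges by construction, and passed from the six parts to their union by
    [X_value_parent]. *)
Lemma X_value_inner c p : ~~ outer c -> (size (c :: p) <= n)%N -> X_value a P (c :: p).
Proof.
move=> oc; move: {-2}(c :: p) (erefl (head eA (c :: p))) (isT : (0 < size (c :: p))%N) => q.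
suff H : (size q <= n)%N -> (0 < size q)%N -> head eA q = c -> X_value a P q by move=> *; apply: H.
move: q; apply: word_ind => [q qn q0 qc|q qn IH q0 qc].
  have [e eE] : exists e : edge n, q = e by exists (Tuple (introT eqP qn)).
  rewrite eE in qc *; rewrite /X_value laakso_stepF size_tuple subnn expr0 scale1r /edge_image.
  have -> : thead e = c by rewrite /thead (tnth_nth eA) nth0.
  by rewrite (negPf oc).
apply: X_value_parent => // d; apply: IH; rewrite ?size_rcons //.
by case: q q0 qc {qn}.
Qed.

Hypothesis Q_tame : tame_projection Q.

(** For A and F both sides vanish: [Q] kills f, and [X [:: c]] is 0 because h_n vanishes there. So
    the formulas for the whole graph may use all six parts. *)
Lemma X_value_root c : X_value a P [:: c].
Proof.
have [_ Qf _ _] := Q_tame.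
have [oc|oc] := boolP (outer c); last exact: X_value_inner.
rewrite /X_value extend0_copy laakso_step_copy // -fvecE Qf linear0.
rewrite -[[:: c]]/(rcons [::] c) X_rcons scaler0 add0r.
have -> : hcoef R c = 0 by case: c oc.
by rewrite mul0r scale0r scaler0.
Qed.

(** The default [eB] of [head] counts the empty word, the whole graph, among the inner ones. *)
Lemma X_value_children p c : (size p < n)%N -> ~~ outer (head eB p) -> X_value a P (rcons p c).
Proof.
case: p => [|d p] pn oc; first exact: X_value_root.
by rewrite rcons_cons; apply: X_value_inner; rewrite //= size_rcons.
Qed.

Lemma laakso_step_H p : (size p < n)%N -> P (Hvec R n p) = Hvec R n p.
Proof.
move=> pn; have [op|op] := boolP (outer (head eB p)); last first.
  by apply: (X_value_H (a := a)) => // c; apply: X_value_children.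
case: p pn op => // c p pn oc; have [[_ Q_id] _ _ _] := Q_tame.
by rewrite /Hvec extend0_copy laakso_step_copy // [Q _]Q_id //; apply: H_in.
Qed.

Lemma laakso_step_nonspecial p c d : (size p < n)%N -> (c, d) \in special_pairs ->
  P (nonspecial R n p c d) = 0.
Proof.
move=> pn cd; have [op|op] := boolP (outer (head eB p)); last first.
  by apply: (X_value_nonspecial (a := a)) => // b; apply: X_value_children.
case: p pn op => // b p pn oc; have [_ _ Qns _] := Q_tame.
by rewrite copy_nonspecial laakso_step_copy // Qns // linear0.
Qed.

Lemma laakso_step_fvec : P (fvec R n) = 0.
Proof.
by rewrite fvecE (X_value_parent (a := a)) ?scaler0 // => c; apply: X_value_children.
Qed.

Lemma laakso_step_G p : (size p < n)%N -> ~~ outer (head eB p) ->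
  P (Gvec R n p) = (sqnorm2 (Gvec R n p) * a (n - size p)) *: X n a p.
Proof. by move=> pn op; apply: X_value_G => // c; apply: X_value_children. Qed.

Lemma laakso_step_tame : tame_projection P.
Proof.
have [[Q_onto _] _ _ Q_norm] := Q_tame.
split; [|exact: laakso_step_fvec|exact: laakso_step_nonspecial|].
  apply: projects_ontoP => [|e]; first exact: laakso_step_H.
  rewrite laakso_stepF /edge_image; case: ifP => _; last by apply: X_in; rewrite size_tuple.
  by apply: copy_cycle_space; rewrite -Q_onto memv_img ?memvf.
move=> e; rewrite laakso_stepF /edge_image; case: ifP => _.
  apply: le_trans (norm1_copy _ _) (le_trans (Q_norm _) _).
  by rewrite ler_pM2r ?invr_gt0 ?ltr0n // ler_nat.
(* For an edge the bound is x_1 = (n + 1) / 2. *)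
have := X_norm (a := a) (p := e) (fun _ _ => erefl); rewrite size_tuple leqnn => /(_ isT).
by rewrite subSn // subnn /xcoef expr0 mul1r subn1.
Qed.

End Step.

(** * Uniqueness and existence *)

Section Uniqueness.
Variable R : realType.

Lemma projection_ext n (P P' : 'End(edge_space R n)) :
  projects_onto P (cycle_space R n) -> projects_onto P' (cycle_space R n) ->
  P (fvec R n) = P' (fvec R n) ->
  (forall p, (size p < n)%N -> P (Gvec R n p) = P' (Gvec R n p)) ->
  (forall p c d, (size p < n)%N -> (c, d) \in special_pairs ->
    P (nonspecial R n p c d) = P' (nonspecial R n p c d)) ->
  P = P'.
Proof.
move=> [_ P_id] [_ P'_id] Pf PG Pns; apply/lfunP; apply: edge_space_ind => //.
  by move=> k x y Px Py; rewrite !linearP /= Px Py.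
by move=> p pn; rewrite P_id ?P'_id ?H_in.
Qed.

Lemma word_in_edge m p : (size p <= m.+1)%N -> (0 < size p)%N ->
  exists2 e : edge m.+1, take (size p) e = p & thead e = head eA p.
Proof.
move=> pm p0; have sz : size (p ++ nseq (m.+1 - size p) eA) == m.+1.
  by rewrite size_cat size_nseq subnKC.
exists (Tuple sz); first by rewrite /= take_size_cat.
by rewrite /thead (tnth_nth eA) /=; case: p p0 {pm sz}.
Qed.

Lemma chain_inner m (e : edge m.+1) : (thead e \in [:: eB; eC; eD; eE]) = ~~ outer (thead e).
Proof. by case: (thead e); rewrite !inE !edge1_eqE. Qed.

(** Only the scalars a_j with 1 <= j < n are determined, and only these are consulted here. *)
Lemma chain_Xrev_ext n a a' (e : edge n) k : {in [pred j | 1 <= j < n]%N, a =1 a'} ->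
  (k < n)%N -> chain_Xrev a e k = chain_Xrev a' e k :> edge_space R n.
Proof.
move=> aa'; elim: k => [//|k IH] kn; rewrite /= IH 1?ltnW // aa' // inE; lia.
Qed.

(** [Q] is unique by induction, the scalars are unique, and every inner sub-graph lies on the chain
    of some edge, so all values on the basis are determined. *)
Lemma laakso_proj_unique n (P P' : 'End(edge_space R n)) :
  is_laakso_proj P -> is_laakso_proj P' -> P = P'.
Proof.
elim: n P P' => [//|m IH] P P' [P_onto +] [P'_onto +].
case: (m =P 0%N) => [m0|m0] /=.
  move=> Pcut P'cut; apply: projection_ext => // *.
  - by rewrite Pcut ?P'cut //; apply: fvec_in_cut.
  - by rewrite Pcut ?P'cut //; apply: G_in_cut.
  - by rewrite Pcut ?P'cut //; apply: nonspecial_in_cut.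
move=> [[Pf PG0 Pns] [Q /IH QQ PQ] [x [a [sc Pa]]]].
move=> [[P'f P'G0 P'ns] [Q' /QQ <- P'Q] [x' [a' [sc' P'a]]]].
have aa' : {in [pred j | 1 <= j < m.+1]%N, a =1 a'}.
  by move=> j jm; rewrite (laakso_scalars_unique sc) // (laakso_scalars_unique sc').
apply: projection_ext => //; first by rewrite Pf P'f.
  case=> [|c p] pm; first by rewrite PG0 P'G0.
  have [oc|oc] := boolP (outer c).
    by rewrite PQ ?P'Q //; case: c oc {pm}; rewrite // !inE ?eqxx ?orbT.
  have [e ep ec] := word_in_edge (ltnW pm) isT.
  have j_range : (1 <= m.+1 - size (c :: p) < m.+1)%N by move: pm => /=; lia.
  have chainE : chain e (m.+1 - size (c :: p)) = c :: p by rewrite /chain subKn ?ep // ltnW.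
  have e_inner : thead e \in [:: eB; eC; eD; eE] by rewrite chain_inner ec.
  have := Pa e _ e_inner j_range; have := P'a e _ e_inner j_range.
  rewrite /= chainE => -> ->; rewrite aa' //; congr (_ *: _).
  by apply: chain_Xrev_ext => //; lia.
by move=> p c d pm cd; rewrite Pns ?P'ns.
Qed.

Lemma laakso_proj_exists m :
  exists P : 'End(edge_space R m.+1), is_laakso_proj P /\ tame_projection P.
Proof.
elim: m => [|m [Q [Q_laakso Q_tame]]].
  (* Starting from the zero map on a single edge lets [laakso_step] produce order 1 as well. *)
  have Q_tame : tame_projection (0 : 'End(edge_space R 0)).
    split; [|by rewrite zero_lfunE|by []|move=> e].
      by apply: projects_ontoP => // e; rewrite zero_lfunE mem0v.
    by rewrite zero_lfunE norm1_0 divr_ge0 ?ler0n.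
  have P_tame := laakso_step_tame Q_tame; have [P_onto Pf Pns _] := P_tame.
  (* At order 1 the only [Gvec] is that of the whole graph, and [X [::]] is 0; hence the whole cut
     space is killed. *)
  exists (laakso_step 0); split=> //; split=> //=; apply: in_cut_kernel => // -[|//] _.
  by rewrite laakso_step_G // scaler0.
have P_tame := laakso_step_tame Q_tame; have [P_onto Pf Pns _] := P_tame.
exists (laakso_step Q); split=> //; split=> //; split.
- by split=> //; rewrite laakso_step_G // scaler0.
- exists Q => // c p cAF pm; rewrite /Gvec extend0_copy laakso_step_copy //.
  by case: c cAF; rewrite !inE !edge1_eqE.
exists (xcoef R m.+2), (acoef R m.+2); split; first exact: laakso_scalars_exist.
move=> e j e_inner /andP[j0 jm] Gj; rewrite /Gj /chain_X.
have sz : size (chain e j) = (m.+2 - j)%N by rewrite size_takel ?size_tuple ?leq_subr.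
(* X_(j+1) belongs to the word of L_j, whose length is m + 2 - j. *)
have -> : chain_Xrev (acoef R m.+2) e (m.+2 - j.+1) = X m.+2 (acoef R m.+2) (chain e j).
  by rewrite chain_XrevE ?subnSK // leq_subr.
rewrite (laakso_step_G Q_tame) ?sz; last 2 first.
- by rewrite ltn_subrL j0.
- move: e_inner; rewrite chain_inner /chain; case/tupleP: e {Gj sz} => c e; rewrite theadE /=.
  by rewrite subSn.
by rewrite subKn ?(ltnW jm).
Qed.

End Uniqueness.

Theorem theorem11 (R : realType) (n : nat) (hn : (1 <= n)%N) :
  (exists! P : 'End(edge_space R n), is_laakso_proj P) /\
  (forall P : 'End(edge_space R n),
     is_laakso_proj P -> opnorm1 P <= n.+1%:R / 2).
Proof.
case: n hn => // m _; have [P [P_laakso [_ _ _ P_norm]]] := laakso_proj_exists R m.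
split; first by exists P; split=> // P'; apply: laakso_proj_unique.
move=> P' /(laakso_proj_unique P_laakso) <-; apply: opnorm1_le => //.
by rewrite divr_ge0 ?ler0n.
Qed.
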